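(* Let $\mathcal{X}_0$ be a set and $E_0,E_1,E_2$ Banach spaces. Let $\mathcal{B}_0(\mathcal{X}_0,E_0)$, $\mathcal{B}_1(E_0,E_1)$, $\mathcal{B}_2(E_1,E_2)$ be three nested GRKBSs with configurations $(\mathcal{F}_0,\phi_0)$, $(\mathcal{F}_1,\phi_1)$, $(\mathcal{F}_2,\phi_2)$ respectively. For each $(\mu_0,\mu_1)\in\mathcal{F}_0\times\mathcal{F}_1$ define $$\mathcal{X}_{\mu_0}=\phi_0(\mathcal{X}_0)(\mu_0)=\{\phi_0(x)(\mu_0):x\in\mathcal{X}_0\}\subset E_0,\qquad \mathcal{X}_{(\mu_0,\mu_1)}=\phi_1(\mathcal{X}_{\mu_0})(\mu_1)=\{\phi_1(e)(\mu_1):e\in\mathcal{X}_{\mu_0}\}\subset E_1.$$ Then there are sequences of isometric isomorphisms $$\mathcal{HL}_{\mu_0}:\ \mathcal{B}_{\mu_0}(\mathcal{X}_0,E_1)\to\mathcal{B}_1(\mathcal{X}_{\mu_0}\subset E_0,E_1)\to\frac{\mathcal{B}_1(E_0,E_1)}{\phi^{(1)}_*\bigl(\mathcal{N}_{\phi_1|_{\mathcal{X}_{\mu_0}}}/\mathcal{N}_{\phi_1}\bigr)}$$ and $$\mathcal{HL}_{(\mu_0,\mu_1)}:\ \mathcal{B}_{(\mu_0,\mu_1)}(\mathcal{X}_0,E_2)\to\mathcal{B}_2(\mathcal{X}_{(\mu_0,\mu_1)}\subset E_1,E_2)\to\frac{\mathcal{B}_2(E_1,E_2)}{\phi^{(2)}_*\bigl(\mathcal{N}_{\phi_2|_{\mathcal{X}_{(\mu_0,\mu_1)}}}/\mathcal{N}_{\phi_2}\bigr)},$$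 where $\phi^{(1)}_*$ and $\phi^{(2)}_*$ are the characteristic isometries of $\mathcal{B}_1(E_0,E_1)$ and $\mathcal{B}_2(E_1,E_2)$.
   Context: $L_{\mathrm{op}}(\mathcal{F},E)$ denotes the bounded linear operators from $\mathcal{F}$ to $E$. For a set $\mathcal{X}$ and Banach space $E$, a GRKBS $\mathcal{B}(\mathcal{X},E)$ is a Banach space of functions $f:\mathcal{X}\to E$ (pointwise operations) for which every evaluation $f\mapsto f(x)$ is bounded. A configuration is a pair $(\mathcal{F},\phi)$, $\mathcal{F}$ a Banach space and $\phi:\mathcal{X}\to L_{\mathrm{op}}(\mathcal{F},E)$ any map, such that $\mathcal{B}(\mathcal{X},E)=\{f_\mu:\mu\in\mathcal{F}\}$, $f_\mu(x)=\phi(x)(\mu)$, with norm $\|f\|=\inf\{\|\mu\|_{\mathcal{F}}:f=f_\mu\}$; any such pair determines a GRKBS this way. Put $\mathcal{N}_\phi=\bigcap_{x\in\mathcal{X}}\ker\phi(x)$. The characteristic isometry is the isometric isomorphism $\phi_*:\mathcal{F}/\mathcal{N}_\phi\to\mathcal{B}(\mathcal{X},E)$, $\phi_*(\mu+\mathcal{N}_\phi)=f_\mu$ (written $\phi^{(i)}_*$ for $(\mathcal{F}_i,\phi_i)$). Quotients carry quotient norms. Restriction: for $\overline{\mathcal{X}}\subset\mathcal{X}$, $\mathcal{B}(\overline{\mathcal{X}}\subset\mathcal{X},E)$ is the GRKBS of functions $\overline{\mathcal{X}}\to E$ with configuration $(\mathcal{F},\phi|_{\overline{\mathcal{X}}})$;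 $\mathcal{N}_{\phi|_{\overline{\mathcal{X}}}}/\mathcal{N}_\phi$ is regarded as a subspace of $\mathcal{F}/\mathcal{N}_\phi$. Compositions: $\mathcal{B}_{\mu_0}(\mathcal{X}_0,E_1)$ is the GRKBS of functions $\mathcal{X}_0\to E_1$ with configuration $(\mathcal{F}_1,\phi_{\mu_0})$, $\phi_{\mu_0}(x)=\phi_1(\phi_0(x)(\mu_0))\in L_{\mathrm{op}}(\mathcal{F}_1,E_1)$. $\mathcal{B}_{(\mu_0,\mu_1)}(\mathcal{X}_0,E_2)$ is the GRKBS of functions $\mathcal{X}_0\to E_2$ with configuration $(\mathcal{F}_2,\phi_{(\mu_0,\mu_1)})$, $\phi_{(\mu_0,\mu_1)}(x)=\phi_2\bigl(\phi_1(\phi_0(x)(\mu_0))(\mu_1)\bigr)\in L_{\mathrm{op}}(\mathcal{F}_2,E_2)$. *)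

(* Defs.v *)
From HB Require Import structures.
From mathcomp Require Import all_boot all_order all_algebra.
From mathcomp Require Import generic_quotient ring_quotient.
From mathcomp Require Import all_classical all_reals.
From mathcomp Require Import interval_inference topology normedtype sequences.

Set Implicit Arguments.
Unset Strict Implicit.
Unset Printing Implicit Defensive.

Import Order.TTheory GRing.Theory Num.Theory.
Import numFieldNormedType.Exports.

Local Open Scope classical_set_scope.
Local Open Scope ring_scope.
Local Open Scope quotient_scope.

Record bounded_linear (R : realType) (V W : normedModType R) := BoundedLinear {
  bounded_linear_fun :> {linear V -> W};
  bounded_linearP : exists M : R, forall v, `|bounded_linear_fun v| <= M * `|v|
}.

Record isometric_isomorphism (R : realType) (V W : normedModType R)
    (T : {linear V -> W}) : Prop := IsometricIsomorphism {
  isometric_isomorphism_bij : bijective T;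
  isometric_isomorphism_norm : forall v, `|T v| = `|v|
}.

Record closed_subspace (R : realType) (V : normedModType R) := ClosedSubspace {
  subspace_set :> set V;
  subspace0 : subspace_set 0;
  subspaceP : forall (a : R) u v,
    subspace_set u -> subspace_set v -> subspace_set (a *: u + v);
  subspace_closed : closed subspace_set
}.

(* The infimum of the norms over the fibres of a linear map p; it is both the
   quotient norm and the norm of a space of functions given by a feature map. *)
Section InfNorm.
Variables (R : realType) (V : normedModType R) (W : lmodType R).
Variable p : {linear V -> W}.

Definition inf_norm (w : W) : R := inf [set `|v| | v in p @^-1` [set w]].

Hypothesis psurj : forall w, exists v, p v = w.
Hypothesis pclosed : closed (p @^-1` [set 0]).

Lemma inf_norm_le v : inf_norm (p v) <= `|v|.
Proof.
apply: ge_inf; last by exists v.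
by exists 0 => _ [u _ <-].
Qed.

Lemma inf_norm_nonempty w : [set `|v| | v in p @^-1` [set w]] !=set0.
Proof. by have [v pv] := psurj w; exists `|v|, v. Qed.

Lemma inf_norm_ge0 w : 0 <= inf_norm w.
Proof.
by apply: lb_le_inf; [exact: inf_norm_nonempty|move=> _ [u _ <-]].
Qed.

Lemma inf_norm_lt w e : inf_norm w < e -> exists2 v, p v = w & `|v| < e.
Proof.
move=> /(inf_lt (inf_norm_nonempty w))[_ [v pv <-] ve].
by exists v.
Qed.

Lemma inf_normD x y : inf_norm (x + y) <= inf_norm x + inf_norm y.
Proof.
apply/ler_addgt0Pr => e e0.
have e20 : 0 < e / 2 by rewrite divr_gt0.
have [u <- ux] : exists2 u, p u = x & `|u| < inf_norm x + e / 2.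
  by apply: inf_norm_lt; rewrite ltrDl.
have [v <- vy] : exists2 v, p v = y & `|v| < inf_norm y + e / 2.
  by apply: inf_norm_lt; rewrite ltrDl.
rewrite -linearD (le_trans (inf_norm_le _))// (le_trans (ler_normD _ _))//.
rewrite [e in leRHS]splitr addrACA lerD//.
- exact: le_trans (ltW ux) _.
- exact: le_trans (ltW vy) _.
Qed.

Lemma inf_normZ_le a w : inf_norm (a *: w) <= `|a| * inf_norm w.
Proof.
apply/ler_addgt0Pr => e e0.
have d0 : 0 < e / (`|a| + 1) by rewrite divr_gt0// ltr_wpDl.
have [u <- uw] : exists2 u, p u = w & `|u| < inf_norm w + e / (`|a| + 1).
  by apply: inf_norm_lt; rewrite ltrDl.
rewrite -linearZ (le_trans (inf_norm_le _))// normrZ.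
rewrite (le_trans (ler_wpM2l _ (ltW uw)))// mulrDr lerD2l mulrCA.
by rewrite ler_piMr ?(ltW e0)// ler_pdivrMr ?mul1r ?lerDl// ltr_wpDl.
Qed.

Lemma inf_normZ a w : inf_norm (a *: w) = `|a| * inf_norm w.
Proof.
apply/eqP; rewrite eq_le inf_normZ_le /=.
have [->|a0] := eqVneq a 0; first by rewrite normr0 mul0r inf_norm_ge0.
rewrite -ler_pdivlMl ?normr_gt0// -normfV.
by rewrite (le_trans _ (inf_normZ_le _ _))// scalerA mulVf// scale1r.
Qed.

Lemma inf_norm_eq0 w : inf_norm w = 0 -> w = 0.
Proof.
have [v <-] := psurj w => w0.
suff : (p @^-1` [set 0]) v by [].
apply: pclosed => B /nbhs_ballP[e /= e0 eB].
have [u pu ue] : exists2 u, p u = p v & `|u| < e.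
  by apply: inf_norm_lt; rewrite w0.
exists (v - u); split; first by rewrite /= linearB pu subrr.
by apply: eB; rewrite -ball_normE /ball_ /= opprB addrC subrK.
Qed.

End InfNorm.

Lemma inf_norm_complete (R : realType) (V : completeNormedModType R)
    (W : normedModType R) (p : {linear V -> W}) :
  (forall w, exists v, p v = w) -> (forall w, `|w| = inf_norm p w) ->
  forall F : set_system W, ProperFilter F -> cauchy F -> cvg F.
Proof.
move=> psurj pnorm F PF /cauchyP Fc.
pose e n : R := 2^-1 ^+ n.
have e0 n : 0 < e n by rewrite exprn_gt0// invr_gt0.
have /choice[w Fw] : forall n, exists w, F (ball w (e n)) by move=> n; exact: Fc.
have /choice[d dP] : forall n, exists d, p d = w n.+1 - w n /\ `|d| < 2 * e n.
  move=> n.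
  have [z [z1 z2]] := filter_ex (filterI (Fw n) (Fw n.+1)).
  have : `|w n.+1 - w n| < 2 * e n.
    have -> : w n.+1 - w n = (w n.+1 - z) - (w n - z) by rewrite opprB addrA subrK.
    rewrite (le_lt_trans (ler_normB _ _))// mulr_natl mulr2n ltrD//.
    - move: z2; rewrite -ball_normE => /lt_le_trans; apply.
      by rewrite /e exprS ler_piMl// ?exprn_ge0 ?invr_ge0// invf_le1// ler1n.
    - by move: z1; rewrite -ball_normE.
  rewrite pnorm => /(inf_norm_lt psurj)[v pv vn].
  by exists v.
have /normed_cvg : cvgn [normed series d].
  apply: (@series_le_cvg _ _ (geometric 2 2^-1)) => [n|n|n|] /=.
  - exact: normr_ge0.
  - by apply: geometric_ge0; rewrite ?invr_ge0.
  - by rewrite ltW//; have [] := dP n.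
  - by apply: is_cvg_geometric_series; rewrite gtr0_norm ?invr_gt0// invf_lt1// ltr1n.
move=> dcvg.
have [v0 pv0] := psurj (w 0%N).
have pS n : p (v0 + series d n) = w n.
  elim: n => [|n IH]; first by rewrite seriesEnat /= big_geq// addr0.
  by rewrite seriesSr addrA linearD IH (dP n).1 addrC subrK.
pose v := v0 + limn (series d).
apply/cvg_ex; exists (p v); apply/cvgrPdist_lt => eps eps0.
have eps20 : 0 < eps / 2 by rewrite divr_gt0.
have cv : (fun n => v0 + series d n) @ \oo --> v by apply: cvgD => //; exact: cvg_cst.
have ce : e @ \oo --> (0 : R).
  have := @cvg_geometric R 1 2^-1; rewrite gtr0_norm ?invr_gt0// invf_lt1// ltr1n//.
  move=> /(_ isT); apply: cvg_trans; apply: near_eq_cvg.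
  by apply: nearW => n /=; rewrite mul1r.
near \oo => n.
have en : e n < eps / 2.
  by near: n; move/cvgrPdist_lt : ce => /(_ _ eps20); apply: filterS => n;
    rewrite sub0r normrN gtr0_norm.
have vn : `|p v - w n| < eps / 2.
  rewrite -pS -linearB pnorm; apply: le_lt_trans (inf_norm_le _ _) _.
  by near: n; move/cvgrPdist_lt : cv => /(_ _ eps20).
apply: filterS (Fw n) => z; rewrite -ball_normE /ball_ /= => wz.
rewrite -(subrKA (w n)) [eps]splitr (le_lt_trans (ler_normD _ _))// ltrD//.
exact: lt_trans wz en.
Unshelve. all: by end_near. Qed.

Section Quotient.
Variables (R : realType) (V : normedModType R) (S : closed_subspace V).

Definition subspace_pred : {pred V} := fun v => v \in (S : set V).

Fact subspace_pred_zmod : zmod_closed subspace_pred.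
Proof.
split=> [|u v]; rewrite /subspace_pred -!topredE /= !inE.
  exact: subspace0.
by move=> Su Sv; rewrite addrC -scaleN1r; exact: subspaceP.
Qed.
HB.instance Definition _ :=
  GRing.isZmodClosed.Build V subspace_pred subspace_pred_zmod.

Definition quotient : Type := Quotient.quot subspace_pred.
HB.instance Definition _ := GRing.Zmodule.on quotient.

Definition coset_of (v : V) : quotient := \pi_(Quotient.quot subspace_pred) v.
Definition coset_repr (q : quotient) : V :=
  repr (q : Quotient.quot subspace_pred).

Lemma coset_reprK q : coset_of (coset_repr q) = q.
Proof. exact: reprK. Qed.

Lemma coset_of_eq u v : coset_of u = coset_of v <-> subspace_set S (u - v).
Proof.
have -> : subspace_set S (u - v) = (u - v \in subspace_pred) :> Prop.
  by rewrite /subspace_pred -topredE /= inE.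
rewrite Quotient.idealrBE; split=> [uv|/eqP//].
by apply/eqP.
Qed.

Fact coset_of_zmod : zmod_morphism coset_of.
Proof. by move=> u v; exact: raddfB. Qed.
HB.instance Definition _ :=
  GRing.isZmodMorphism.Build V quotient coset_of coset_of_zmod.

Definition quotient_scale (a : R) (q : quotient) : quotient :=
  coset_of (a *: coset_repr q).

Lemma quotient_scaleE a v : quotient_scale a (coset_of v) = coset_of (a *: v).
Proof.
apply/coset_of_eq; rewrite -scalerBr -[_ *: _]addr0; apply: subspaceP.
  by apply/coset_of_eq; rewrite coset_reprK.
exact: subspace0.
Qed.

Fact quotient_scalerA a b q :
  quotient_scale a (quotient_scale b q) = quotient_scale (a * b) q.
Proof. by rewrite -[q]coset_reprK !quotient_scaleE scalerA. Qed.

Fact quotient_scale1r : left_id 1 quotient_scale.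
Proof. by move=> q; rewrite -[q]coset_reprK quotient_scaleE scale1r. Qed.

Fact quotient_scalerDr : right_distributive quotient_scale +%R.
Proof.
move=> a q r; rewrite -[q]coset_reprK -[r]coset_reprK.
by rewrite -raddfD !quotient_scaleE scalerDr raddfD.
Qed.

Fact quotient_scalerDl q : {morph quotient_scale^~ q : a b / a + b}.
Proof.
by move=> a b; rewrite -[q]coset_reprK !quotient_scaleE scalerDl raddfD.
Qed.

HB.instance Definition _ := GRing.Zmodule_isLmodule.Build R quotient
  quotient_scalerA quotient_scale1r quotient_scalerDr quotient_scalerDl.

Fact coset_of_scalable : scalable coset_of.
Proof. by move=> a v; rewrite -quotient_scaleE. Qed.
HB.instance Definition _ :=
  GRing.isScalable.Build R V quotient *:%R coset_of coset_of_scalable.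

Lemma coset_of_surj (q : quotient) : exists v, coset_of v = q.
Proof. by exists (coset_repr q); exact: coset_reprK. Qed.

Lemma coset_of_ker : coset_of @^-1` [set 0] = S.
Proof.
apply/seteqP; split=> v /=.
  by rewrite -(raddf0 coset_of) => /coset_of_eq; rewrite subr0.
by move=> Sv; rewrite -(raddf0 coset_of); apply/coset_of_eq; rewrite subr0.
Qed.

Fact coset_of_closed : closed (coset_of @^-1` [set 0]).
Proof. by rewrite coset_of_ker; exact: subspace_closed. Qed.

HB.instance Definition _ := @Lmodule_isNormed.Build R quotient
  (inf_norm coset_of) (inf_normD coset_of_surj) (inf_normZ coset_of_surj)
  (inf_norm_eq0 coset_of_surj coset_of_closed).

Lemma quotient_normE (q : quotient) : `|q| = inf_norm coset_of q.
Proof. by []. Qed.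

End Quotient.

HB.instance Definition _ (R : realType) (V : completeNormedModType R)
    (S : closed_subspace V) := Uniform_isComplete.Build (quotient S)
  (inf_norm_complete (@coset_of_surj R V S) (@quotient_normE R V S)).

Section GRKBS.
Variables (R : realType) (X : Type) (E : completeNormedModType R).

(* A Banach space of functions is encoded by an abstract Banach space together
   with an injective linear map, grkbs_fun, reading its elements as functions
   (X -> E carries the pointwise operations). *)
Record grkbs := GRKBS {
  grkbs_space :> completeNormedModType R;
  grkbs_fun : {linear grkbs_space -> (X -> E)};
  grkbs_fun_inj : injective grkbs_fun;
  grkbs_eval_bounded : forall x : X,
    exists M : R, forall f : grkbs_space, `|grkbs_fun f x| <= M * `|f|
}.

Variable F : completeNormedModType R.
Implicit Type phi : X -> bounded_linear F E.

Definition feature_fun phi (mu : F) : X -> E := fun x => phi x mu.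

Record configuration (B : grkbs) phi : Prop := Configuration {
  configuration_range :
    range (grkbs_fun B) = range (feature_fun phi);
  configuration_norm : forall f : B,
    `|f| = inf [set `|mu| | mu in [set mu | grkbs_fun B f = feature_fun phi mu]]
}.

Fact feature_fun_linear phi : linear (feature_fun phi).
Proof. by move=> a u v; apply/funext => x; rewrite /feature_fun linearP. Qed.
HB.instance Definition _ phi :=
  GRing.isLinear.Build R F (X -> E) *:%R (feature_fun phi) (feature_fun_linear phi).

Definition null_set phi : set F :=
  \bigcap_(x in [set: X]) (phi x @^-1` [set 0]).

Lemma null_setE phi : null_set phi = feature_fun phi @^-1` [set 0].
Proof.
apply/seteqP; split=> [mu N0|mu /= N0 x _ /=].
  by apply/funext => x; exact: N0.
by have /(congr1 (fun f => f x)) := N0.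
Qed.

Fact null_set0 phi : null_set phi 0.
Proof. by rewrite null_setE /= linear0. Qed.

Fact null_setP phi (a : R) u v :
  null_set phi u -> null_set phi v -> null_set phi (a *: u + v).
Proof.
by rewrite !null_setE /= => u0 v0; rewrite linearP /= u0 v0 scaler0 addr0.
Qed.

Fact bounded_linear_continuous_fun (phi : bounded_linear F E) :
  continuous (phi : F -> E).
Proof.
apply: bounded_linear_continuous; apply/linear_boundedP.
have [M phiM] := bounded_linearP phi.
near=> r => v; apply: le_trans (phiM v) _; rewrite ler_wpM2r//.
by near: r; exact: nbhs_pinfty_ge (num_real _).
Unshelve. all: by end_near. Qed.

Fact null_set_closed phi : closed (null_set phi).
Proof.
apply: closed_bigI => x _; apply: preimage_closed.
  by move=> mu _; exact: bounded_linear_continuous_fun.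
exact: accessible_closed_set1 (hausdorff_accessible (@norm_hausdorff _ _)) _.
Qed.

Definition null_space phi : closed_subspace F :=
  ClosedSubspace (null_set0 phi) (@null_setP phi) (@null_set_closed phi).

Lemma null_coset_eq phi u v :
  coset_of (null_space phi) u = coset_of (null_space phi) v <->
  feature_fun phi u = feature_fun phi v.
Proof.
rewrite coset_of_eq /= null_setE /= linearB /=.
by split=> [/eqP|->]; [rewrite subr_eq0 => /eqP|rewrite subrr].
Qed.

(* Here the elements are literally the functions f_mu, so grkbs_fun is \val. *)
Section Construction.
Variable phi : X -> bounded_linear F E.

Definition feature_pred : {pred X -> E} :=
  fun f => `[< range (feature_fun phi) f >].

Fact feature_pred_submod : submod_closed feature_pred.
Proof.
split=> [|a f g]; rewrite /feature_pred -!topredE /=.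
  by apply/asboolP; exists 0 => //; rewrite linear0.
move=> /asboolP[u _ <-] /asboolP[v _ <-]; apply/asboolP.
by exists (a *: u + v) => //; rewrite linearP.
Qed.
HB.instance Definition _ :=
  GRing.isSubmodClosed.Build R (X -> E) feature_pred feature_pred_submod.

Definition feature_space : Type := {f : X -> E | feature_pred f}.
HB.instance Definition _ := Choice.on feature_space.
HB.instance Definition _ := SubChoice.on feature_space.
HB.instance Definition _ := [SubChoice_isSubLmodule of feature_space by <:].

Fact feature_in mu : feature_pred (feature_fun phi mu).
Proof. by apply/asboolP; exists mu. Qed.

Definition feature_map (mu : F) : feature_space :=
  exist (fun f => feature_pred f) (feature_fun phi mu) (feature_in mu).

Fact feature_map_linear : linear feature_map.
Proof. by move=> a u v; apply: val_inj; rewrite /= linearP. Qed.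
HB.instance Definition _ := GRing.isLinear.Build R F feature_space *:%R
  feature_map feature_map_linear.

Lemma feature_map_surj (f : feature_space) : exists mu, feature_map mu = f.
Proof.
case: f => f pf; have /asboolP[mu _ muf] := pf.
by exists mu; exact: val_inj.
Qed.

Fact feature_map_closed : closed (feature_map @^-1` [set 0]).
Proof.
rewrite (_ : _ @^-1` _ = null_set phi); first exact: null_set_closed.
rewrite null_setE; apply/seteqP; split=> mu /= mu0.
  by have /(congr1 val) := mu0.
exact: val_inj.
Qed.

HB.instance Definition _ := @Lmodule_isNormed.Build R feature_space
  (inf_norm feature_map) (inf_normD feature_map_surj)
  (inf_normZ feature_map_surj)
  (inf_norm_eq0 feature_map_surj feature_map_closed).

Lemma feature_space_normE (f : feature_space) : `|f| = inf_norm feature_map f.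
Proof. by []. Qed.

HB.instance Definition _ := Uniform_isComplete.Build feature_space
  (inf_norm_complete feature_map_surj feature_space_normE).

Fact feature_space_eval (x : X) :
  exists M : R, forall f : feature_space, `|\val f x| <= M * `|f|.
Proof.
have [M phiM] := bounded_linearP (phi x).
exists `|M| => f; apply/ler_addgt0Pr => e e0.
have d0 : 0 < e / (`|M| + 1) by rewrite divr_gt0// ltr_wpDl.
have [mu <- mun] : exists2 mu, feature_map mu = f &
    `|mu| < `|f| + e / (`|M| + 1).
  by apply: (inf_norm_lt feature_map_surj); rewrite -feature_space_normE ltrDl.
rewrite (le_trans (phiM mu))// (le_trans (ler_wpM2r _ (ler_norm M)))//.
rewrite (le_trans (ler_wpM2l _ (ltW mun)))// mulrDr lerD2l mulrCA.
by rewrite ler_piMr ?(ltW e0)// ler_pdivrMr ?mul1r ?lerDl// ltr_wpDl.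
Qed.

Definition config_grkbs : grkbs :=
  @GRKBS feature_space \val val_inj feature_space_eval.

Lemma config_grkbsP : configuration config_grkbs phi.
Proof.
split=> [|f].
  apply/seteqP; split=> [_ [[f pf] _ <-]|_ [mu _ <-]].
    exact/asboolP.
  by exists (feature_map mu).
congr (inf (_ @` _)); apply/seteqP; split=> mu /= => [<-//|fmu].
exact: val_inj.
Qed.

End Construction.

Section CharacteristicIsometry.
Variables (B : grkbs) (phi : X -> bounded_linear F E).
Hypothesis Bphi : configuration B phi.

Fact configuration_lift mu : exists f : B, grkbs_fun B f = feature_fun phi mu.
Proof.
have : range (grkbs_fun B) (feature_fun phi mu).
  by rewrite (configuration_range Bphi); exists mu.
by case=> f _ <-; exists f.
Qed.

Definition char_isometry_fun (q : quotient (null_space phi)) : B :=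
  sval (cid (configuration_lift (coset_repr q))).

Lemma char_isometry_funE mu :
  grkbs_fun B (char_isometry_fun (coset_of (null_space phi) mu)) =
  feature_fun phi mu.
Proof.
rewrite /char_isometry_fun; case: cid => f /= ->.
by apply/null_coset_eq; rewrite coset_reprK.
Qed.

Fact char_isometry_linear : linear char_isometry_fun.
Proof.
move=> a q r; rewrite -[q]coset_reprK -[r]coset_reprK.
apply: (@grkbs_fun_inj B).
by rewrite -linearP char_isometry_funE !linearP !char_isometry_funE.
Qed.

Definition char_isometry : {linear quotient (null_space phi) -> B} :=
  HB.pack char_isometry_fun
    (GRing.isLinear.Build _ _ _ _ char_isometry_fun char_isometry_linear).

Lemma char_isometryE mu :
  grkbs_fun B (char_isometry (coset_of (null_space phi) mu)) =
  feature_fun phi mu.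
Proof. exact: char_isometry_funE. Qed.

Lemma char_isometryP : isometric_isomorphism char_isometry.
Proof.
have inj : injective char_isometry.
  move=> q r; rewrite -[q]coset_reprK -[r]coset_reprK.
  move=> /(congr1 (grkbs_fun B)); rewrite !char_isometryE => qr.
  exact/null_coset_eq.
split.
  have surj f : exists q, char_isometry q = f.
    have : range (feature_fun phi) (grkbs_fun B f).
      by rewrite -(configuration_range Bphi); exists f.
    case=> mu _ muf; exists (coset_of _ mu); apply: (@grkbs_fun_inj B).
    by rewrite char_isometryE.
  have /choice[g gK] := surj.
  by exists g => // q; apply: inj.
move=> q; rewrite (configuration_norm Bphi) quotient_normE.
rewrite -[q]coset_reprK char_isometryE.
congr (inf (_ @` _)); apply/seteqP; split=> mu /=.
  by move/null_coset_eq.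
by move=> qmu; apply/null_coset_eq.
Qed.

End CharacteristicIsometry.
End GRKBS.

Section Subspaces.
Variables (R : realType) (V W : normedModType R).

(* T / S as a subspace of V / S; it is closed because S is contained in T. *)
Section QuotientSubspace.
Variables (S T : closed_subspace V).
Hypothesis ST : (S : set V) `<=` T.

Fact quotient_subspace0 : (coset_of S @` T) 0.
Proof. by exists 0; [exact: subspace0|rewrite linear0]. Qed.

Fact quotient_subspaceP (a : R) q r :
  (coset_of S @` T) q -> (coset_of S @` T) r -> (coset_of S @` T) (a *: q + r).
Proof.
move=> [u Tu <-] [v Tv <-]; exists (a *: u + v); first exact: subspaceP.
by rewrite linearP.
Qed.

Fact quotient_subspace_closed : closed (coset_of S @` T).
Proof.
move=> q; rewrite -[q]coset_reprK; set v := coset_repr q => Tq.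
exists v => //; apply: (subspace_closed (c := T)) => B /nbhs_ballP[e /= e0 eB].
have [_ [[t Tt <-]]] := Tq _ (nbhsx_ballx _ _ e0).
rewrite -ball_normE /= -linearB quotient_normE.
move=> /(inf_norm_lt (@coset_of_surj R V S))[u /coset_of_eq uS ue].
exists (v - u); split; last first.
  by apply: eB; rewrite -ball_normE /ball_ /= opprB addrC subrK.
rewrite (_ : v - u = (-1) *: (u - (v - t)) + t).
  by apply: subspaceP Tt; exact: ST.
by rewrite scaleN1r !opprB addrAC subrK.
Qed.

Definition quotient_subspace : closed_subspace (quotient S) :=
  ClosedSubspace quotient_subspace0 quotient_subspaceP quotient_subspace_closed.

End QuotientSubspace.

Section ImageSubspace.
Variable T : {linear V -> W}.
Hypothesis Tiso : isometric_isomorphism T.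
Variable S : closed_subspace V.

Fact image_subspace0 : (T @` S) 0.
Proof. by exists 0; [exact: subspace0|rewrite linear0]. Qed.

Fact image_subspaceP (a : R) x y :
  (T @` S) x -> (T @` S) y -> (T @` S) (a *: x + y).
Proof.
move=> [u Su <-] [v Sv <-]; exists (a *: u + v); first exact: subspaceP.
by rewrite linearP.
Qed.

Fact image_subspace_closed : closed (T @` S).
Proof.
move=> w; have [g _ gK] := isometric_isomorphism_bij Tiso.
rewrite -[w]gK; set v := g w => Sw.
exists v => //; apply: (subspace_closed (c := S)) => B /nbhs_ballP[e /= e0 eB].
have [_ [[s Ss <-]]] := Sw _ (nbhsx_ballx _ _ e0).
rewrite -ball_normE /= -linearB (isometric_isomorphism_norm Tiso) => vs.
by exists s; split => //; apply: eB; rewrite -ball_normE.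
Qed.

Definition image_subspace : closed_subspace W :=
  ClosedSubspace image_subspace0 image_subspaceP image_subspace_closed.

End ImageSubspace.
End Subspaces.

Section Restriction.
Variables (R : realType) (X : Type) (E F : completeNormedModType R).
Variables (phi : X -> bounded_linear F E) (A : set X).

Definition feature_restrict : A -> bounded_linear F E := fun x => phi (val x).

Definition restrict_grkbs : grkbs A E := config_grkbs feature_restrict.

Fact null_restrict_sub :
  (null_space phi : set F) `<=` null_space feature_restrict.
Proof. by move=> mu N x _; exact: N. Qed.

(* N_{phi|A} / N_phi, inside F / N_phi *)
Definition null_quotient : closed_subspace (quotient (null_space phi)) :=
  quotient_subspace null_restrict_sub.

(* phi_* (N_{phi|A} / N_phi), inside B *)
Definition char_image (B : grkbs X E) (Bphi : configuration B phi) :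
    closed_subspace B :=
  image_subspace (char_isometryP Bphi) null_quotient.

End Restriction.

Section Composition.
Variables (R : realType) (X0 : Type) (E0 E1 E2 : completeNormedModType R).
Variables (F0 F1 F2 : completeNormedModType R).
Variables (phi0 : X0 -> bounded_linear F0 E0) (phi1 : E0 -> bounded_linear F1 E1).
Variable phi2 : E1 -> bounded_linear F2 E2.
Variables (mu0 : F0) (mu1 : F1).

Definition feature_comp1 : X0 -> bounded_linear F1 E1 :=
  fun x => phi1 (phi0 x mu0).

Definition feature_comp2 : X0 -> bounded_linear F2 E2 :=
  fun x => phi2 (phi1 (phi0 x mu0) mu1).

Definition layer1 : set E0 := [set phi0 x mu0 | x in [set: X0]].

Definition layer2 : set E1 := [set phi1 e mu1 | e in layer1].

End Composition.

(* Main.v *)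
(* Every space in the statement is the target of a metric surjection from a
   parameter space F: a surjective linear map for which the norm downstairs is
   the infimum of the norms over the fibres. Metric surjections compose, and two
   metric surjections out of F with the same kernel have isometrically isomorphic
   targets, so only kernels have to be compared. *)

Require Import Defs.
From HB Require Import structures.
From mathcomp Require Import all_boot all_order all_algebra.
From mathcomp Require Import all_classical all_reals.
From mathcomp Require Import topology normedtype.

Set Implicit Arguments.
Unset Strict Implicit.
Unset Printing Implicit Defensive.

Import Order.TTheory GRing.Theory Num.Theory.
Import numFieldNormedType.Exports.

Local Open Scope classical_set_scope.
Local Open Scope ring_scope.

Section MetricSurjection.
Variable R : realType.

Definition metric_surjection (V W : normedModType R) (p : {linear V -> W}) :=
  (forall w, exists v, p v = w) /\ (forall w, `|w| = inf_norm p w).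

(** Both maps are norm-decreasing, which gives one inequality; near-optimal lifts taken first
    through [q], then through [p], give the other. *)
Lemma metric_surjection_comp (V W Z : normedModType R)
    (p : {linear V -> W}) (q : {linear W -> Z}) :
  metric_surjection p -> metric_surjection q ->
  metric_surjection (q \o p : {linear V -> Z}).
Proof.
move=> [psurj pnorm] [qsurj qnorm].
have qpsurj z : exists v, (q \o p : {linear V -> Z}) v = z.
  have [w <-] := qsurj z; have [v <-] := psurj w.
  by exists v.
split=> // z; apply/eqP; rewrite eq_le; apply/andP; split.
  apply: lb_le_inf; first exact: (inf_norm_nonempty qpsurj).
  move=> _ [v /= <- <-]; rewrite qnorm (le_trans (inf_norm_le _ _))//.
  by rewrite pnorm inf_norm_le.
apply/ler_addgt0Pr => e e0.
have [w <- wz] : exists2 w, q w = z & `|w| < `|z| + e.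
  by apply: (inf_norm_lt qsurj); rewrite -qnorm ltrDl.
(* The bound on [w] is strict, so the lift of [w] can stay under the same bound and no second
   epsilon is needed. *)
have [v <- vw] : exists2 v, p v = w & `|v| < `|q w| + e.
  by apply: (inf_norm_lt psurj); rewrite -pnorm.
exact: le_trans (inf_norm_le (q \o p : {linear V -> Z}) v) (ltW vw).
Qed.

(** The fibres are singletons, so the infimum is taken over a single norm. *)
Lemma isometric_isomorphism_metric_surjection (V W : normedModType R)
    (T : {linear V -> W}) :
  isometric_isomorphism T -> metric_surjection T.
Proof.
move=> [[g gK Kg] Tnorm]; split=> w; first by exists (g w).
rewrite /inf_norm (_ : [set _ | _ in _] = [set `|w|]) ?inf1//.
apply/seteqP; split=> [_ [v /= <- <-]|_ ->]; first by rewrite Tnorm.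
by exists (g w); rewrite /= ?Kg// -Tnorm Kg.
Qed.

Lemma coset_of_metric_surjection (V : normedModType R) (S : closed_subspace V) :
  metric_surjection (coset_of S : {linear V -> quotient S}).
Proof. by split; [exact: coset_of_surj|]. Qed.

(** Equal kernels mean equal fibres: [q] factors through [p], and both norms are infima over the
    same sets. *)
Lemma metric_surjection_iso (V W Z : normedModType R)
    (p : {linear V -> W}) (q : {linear V -> Z}) :
  metric_surjection p -> metric_surjection q ->
  (forall v, p v = 0 <-> q v = 0) ->
  exists T : {linear W -> Z}, isometric_isomorphism T.
Proof.
move=> [psurj pnorm] [qsurj qnorm] ker.
have fibre u v : p u = p v <-> q u = q v.
  have := ker (u - v); rewrite !linearB.
  by move=> [pq qp]; split=> uv; apply: subr0_eq; [apply: pq|apply: qp];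
    rewrite uv subrr.
have /choice[s sK] := psurj; have /choice[t tK] := qsurj.
(* The section [s] is only a choice of preimages and need not be linear; linearity of [f] follows
   from [f (p v) = q v]. *)
pose f w := q (s w).
have fp v : f (p v) = q v by apply/fibre; rewrite sK.
have flin : linear f.
  by move=> a w w'; rewrite -[w]sK -[w']sK -linearP !fp linearP.
pose T : {linear W -> Z} := HB.pack f (GRing.isLinear.Build _ _ _ _ f flin).
exists T; split=> [|w].
  exists (p \o t) => [w|z] /=; last by rewrite fp tK.
  by rewrite -[RHS]sK; apply/fibre; rewrite tK.
rewrite -[w]sK [T _]fp pnorm qnorm.
by congr (inf (_ @` _)); apply/seteqP; split=> v /= /fibre.
Qed.

End MetricSurjection.

Section Features.
Variables (R : realType) (X : Type) (E F : completeNormedModType R).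
Variable phi : X -> bounded_linear F E.

Lemma feature_map_metric_surjection :
  metric_surjection (feature_map phi : {linear F -> config_grkbs phi}).
Proof. by split; [exact: feature_map_surj|]. Qed.

Lemma feature_map_eq0 mu : feature_map phi mu = 0 <-> forall x, phi x mu = 0.
Proof.
split=> [/(congr1 val)/= mu0 x|mu0]; first exact: (congr1 (fun f => f x) mu0).
by apply: val_inj; apply/funext => x; exact: mu0.
Qed.

End Features.

(** Both sides are metric images of [F], the right one through [F / N_phi], then [B], then the
    quotient of [B]. Both kernels are the null space of [phi] restricted to [A]. *)
Lemma restrict_char_image_iso (R : realType) (X : Type)
    (E F : completeNormedModType R) (phi : X -> bounded_linear F E)
    (B : grkbs X E) (c : configuration B phi) (A : set X) :
  exists T : {linear restrict_grkbs phi A -> quotient (char_image A c)},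
    isometric_isomorphism T.
Proof.
have ciso := char_isometryP c.
have q1 := metric_surjection_comp (coset_of_metric_surjection (null_space phi))
  (isometric_isomorphism_metric_surjection ciso).
have q2 := metric_surjection_comp q1
  (coset_of_metric_surjection (char_image A c)).
apply: (metric_surjection_iso
  (feature_map_metric_surjection (feature_restrict phi (A := A))) q2) => mu.
have -> : (coset_of (char_image A c) (char_isometry c (coset_of _ mu)) = 0) =
    subspace_set (char_image A c)
      (char_isometry c (coset_of (null_space phi) mu)).
  by rewrite -[in RHS]coset_of_ker.
rewrite feature_map_eq0; split=> [mu0|[_ [nu nu0 <-]]].
  by exists (coset_of _ mu) => //; exists mu => // x _; exact: mu0.
(* By injectivity of the characteristic isometry, [mu] and some [nu] vanishing on [A] define the
   same function. *)
move=> /(bij_inj (isometric_isomorphism_bij ciso))/null_coset_eq numu x.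
by rewrite -(nu0 x I); have /esym := congr1 (fun f => f (val x)) numu.
Qed.

(** The kernel of a feature map depends only on the set of operators that occur, not on how points
    index them. *)
Lemma reparametrization_iso (R : realType) (X Y : Type)
    (E F : completeNormedModType R) (phi : X -> bounded_linear F E)
    (psi : Y -> bounded_linear F E) :
  range phi = range psi ->
  exists T : {linear config_grkbs phi -> config_grkbs psi},
    isometric_isomorphism T.
Proof.
move=> phipsi; apply: (metric_surjection_iso
  (feature_map_metric_surjection phi) (feature_map_metric_surjection psi)) => mu.
rewrite !feature_map_eq0; split=> mu0 x.
  have [y _ <-] : range phi (psi x) by rewrite phipsi; exists x.
  exact: mu0.
have [y _ <-] : range psi (phi x) by rewrite -phipsi; exists x.
exact: mu0.
Qed.

(** Lets composed features be compared with features restricted to the set of values reached by the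
    inner layers. *)
Lemma range_feature_restrict (R : realType) (X Y : Type)
    (E F : completeNormedModType R) (phi : X -> bounded_linear F E)
    (g : Y -> X) (A : set X) :
  range g = A -> range (phi \o g) = range (feature_restrict phi (A := A)).
Proof.
move=> <-; apply/seteqP; split=> [_ [y _ <-]|_ [[x xg] _ <-]].
  have yg : g y \in range g by rewrite inE; exists y.
  by exists (exist _ (g y) yg).
by have := xg; rewrite inE => -[y _ yx]; exists y => //=; rewrite yx.
Qed.

Theorem proposition20 (R : realType) (X0 : Type)
    (E0 E1 E2 : completeNormedModType R)
    (B0 : grkbs X0 E0) (B1 : grkbs E0 E1) (B2 : grkbs E1 E2)
    (F0 F1 F2 : completeNormedModType R)
    (phi0 : X0 -> bounded_linear F0 E0)
    (phi1 : E0 -> bounded_linear F1 E1)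
    (phi2 : E1 -> bounded_linear F2 E2)
    (c0 : configuration B0 phi0)
    (c1 : configuration B1 phi1)
    (c2 : configuration B2 phi2)
    (mu0 : F0) (mu1 : F1) :
  (exists (U : {linear config_grkbs (feature_comp1 phi0 phi1 mu0) ->
                       restrict_grkbs phi1 (layer1 phi0 mu0)})
          (V : {linear restrict_grkbs phi1 (layer1 phi0 mu0) ->
                       quotient (char_image (layer1 phi0 mu0) c1)}),
    isometric_isomorphism U /\ isometric_isomorphism V) /\
  (exists (U : {linear config_grkbs (feature_comp2 phi0 phi1 phi2 mu0 mu1) ->
                       restrict_grkbs phi2 (layer2 phi0 phi1 mu0 mu1)})
          (V : {linear restrict_grkbs phi2 (layer2 phi0 phi1 mu0 mu1) ->
                       quotient (char_image (layer2 phi0 phi1 mu0 mu1) c2)}),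
    isometric_isomorphism U /\ isometric_isomorphism V).
Proof.
split.
- have [V Viso] := restrict_char_image_iso c1 (layer1 phi0 mu0).
  (* [layer1] unfolds to a range, so reflexivity suffices. *)
  have [U Uiso] := reparametrization_iso
    (range_feature_restrict phi1 (erefl (layer1 phi0 mu0))).
  by exists U, V.
(* [layer2] is an image of an image and must first be fused into the range of one map. *)
- have layer2E : range (fun x => phi1 (phi0 x mu0) mu1) = layer2 phi0 phi1 mu0 mu1.
    by rewrite /layer2 /layer1 image_comp.
  have [V Viso] := restrict_char_image_iso c2 (layer2 phi0 phi1 mu0 mu1).
  have [U Uiso] := reparametrization_iso (range_feature_restrict phi2 layer2E).
  by exists U, V.
Qed.
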